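(* Let $(G,\tau,\partial)$ be a Polish topometric group with ample generics. Let $k_n\in G$ and $A_n\subseteq G$ for $n\in\mathbb N$ be such that $\bigcup_{n\in\mathbb N}k_nA_n$ is co-meagre in $G$. Then there is some $n$ such that for all $\varepsilon>0$, $$1_G\in\mathrm{Int}_\tau\Big(\big(A_n^{-1}A_nA_n^{-1}A_n^{-1}A_nA_n^{-1}A_nA_nA_n^{-1}A_n\big)_\varepsilon\Big).$$
   Context: A Polish topometric group is a triple $(G,\tau,\partial)$ with $(G,\tau)$ a Polish group, $\partial$ a bi-invariant metric whose topology refines $\tau$ and which is $\tau$-lower semi-continuous. For $A\subseteq G$, $(A)_\varepsilon=\{g\colon\partial(g,A)<\varepsilon\}$. $G^n$ has the product topology and supremum metric, and $G$ acts on $G^n$ by diagonal conjugation. $(G,\tau,\partial)$ has ample generics if for all $n\in\mathbb N$ and $\varepsilon>0$ there is $\bar g\in G^n$ with $(\{(kg_0k^{-1},\dots,kg_{n-1}k^{-1})\colon k\in G\})_\varepsilon$ co-meagre in $G^n$. Products $A_n^{-1}A_n\cdots$ denote sets of products of elements. *)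

(* Defs.v *)
From HB Require Import structures.
From mathcomp Require Import all_boot all_order all_algebra.
From mathcomp Require Import all_classical all_reals all_analysis.
From mathcomp Require Import Rstruct Rstruct_topology.

Set Implicit Arguments.
Unset Strict Implicit.
Unset Printing Implicit Defensive.

Import Order.TTheory GRing.Theory Num.Theory.
Local Open Scope classical_set_scope.
Local Open Scope ring_scope.


Definition nowhere_dense {T : topologicalType} (A : set T) : Prop :=
  interior (closure A) = set0.

Definition meagre {T : topologicalType} (A : set T) : Prop :=
  exists F : nat -> set T, (forall n, nowhere_dense (F n)) /\
    A `<=` \bigcup_n F n.

Definition comeagre {T : topologicalType} (A : set T) : Prop :=
  meagre (~` A).

Definition is_metric {T : Type} (d : T -> T -> Rdefinitions.R) : Prop :=
  [/\ forall x y, d x y = 0 <-> x = y,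
      forall x y, d x y = d y x &
      forall x y z, d x z <= d x y + d y z].

Definition dball {T : Type} (d : T -> T -> Rdefinitions.R) (x : T) (r : Rdefinitions.R) : set T :=
  [set y | d x y < r].

Definition metric_induces_topology {T : topologicalType} (d : T -> T -> Rdefinitions.R) :
  Prop :=
  forall A : set T, open A <->
    (forall x, A x -> exists2 r : Rdefinitions.R, 0 < r & dball d x r `<=` A).

Definition metric_complete {T : Type} (d : T -> T -> Rdefinitions.R) : Prop :=
  forall u : nat -> T,
    (forall e : Rdefinitions.R, 0 < e -> exists N, forall m n, (N <= m)%N -> (N <= n)%N ->
        d (u m) (u n) < e) ->
    exists x, forall e : Rdefinitions.R, 0 < e -> exists N, forall n, (N <= n)%N ->
        d (u n) x < e.

Definition separable_space (T : topologicalType) : Prop :=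
  exists u : nat -> T, dense (range u).

Definition polish_space (T : topologicalType) : Prop :=
  separable_space T /\
  exists d : T -> T -> Rdefinitions.R,
    [/\ is_metric d, metric_induces_topology d & metric_complete d].

Definition group_axioms {G : Type} (mul : G -> G -> G) (inv : G -> G) (idG : G)
  : Prop :=
  [/\ forall x y z, mul x (mul y z) = mul (mul x y) z,
      forall x, mul idG x = x, forall x, mul x idG = x,
      forall x, mul (inv x) x = idG & forall x, mul x (inv x) = idG].

Definition polish_group (G : topologicalType) (mul : G -> G -> G) (inv : G -> G)
  (idG : G) : Prop :=
  [/\ group_axioms mul inv idG,
      continuous (fun p : G * G => mul p.1 p.2),
      continuous inv & polish_space G].

Definition polish_topometric_group (G : topologicalType) (mul : G -> G -> G)
  (inv : G -> G) (idG : G) (d : G -> G -> Rdefinitions.R) : Prop :=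
  [/\ polish_group mul inv idG,
      is_metric d,
      (forall g x y, d (mul g x) (mul g y) = d x y) /\
      (forall g x y, d (mul x g) (mul y g) = d x y),
      (forall A : set G, open A ->
         forall x, A x -> exists2 r : Rdefinitions.R, 0 < r & dball d x r `<=` A) &
      (forall r : Rdefinitions.R, closed [set p : G * G | d p.1 p.2 <= r])].

Definition eps_nbhd {T : Type} (d : T -> T -> Rdefinitions.R) (A : set T) (eps : Rdefinitions.R)
  : set T :=
  [set g | exists2 a, A a & d g a < eps].

Definition tupleG (G : topologicalType) (n : nat) := {ptws 'I_n -> G}.

Definition sup_eps_nbhd {G : Type} (n : nat) (d : G -> G -> Rdefinitions.R)
  (B : set ('I_n -> G)) (eps : Rdefinitions.R) : set ('I_n -> G) :=
  [set x | exists2 b, B b & forall i, d (x i) (b i) < eps].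

Definition conj_orbit {G : Type} (mul : G -> G -> G) (inv : G -> G) (n : nat)
  (g : 'I_n -> G) : set ('I_n -> G) :=
  [set h | exists k : G, h = (fun i => mul (mul k (g i)) (inv k))].

Definition ample_generics (G : topologicalType) (mul : G -> G -> G)
  (inv : G -> G) (d : G -> G -> Rdefinitions.R) : Prop :=
  forall (n : nat) (eps : Rdefinitions.R), 0 < eps ->
    exists g : 'I_n -> G,
      @comeagre (tupleG G n) (sup_eps_nbhd d (conj_orbit mul inv g) eps).

Definition setmul {G : Type} (mul : G -> G -> G) (A B : set G) : set G :=
  [set x | exists a b, [/\ A a, B b & x = mul a b]].

Definition setinv {G : Type} (inv : G -> G) (A : set G) : set G :=
  [set x | A (inv x)].

Definition ltrans {G : Type} (mul : G -> G -> G) (k : G) (A : set G) : set G :=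
  [set mul k a | a in A].

Definition word10 {G : Type} (mul : G -> G -> G) (inv : G -> G) (A : set G)
  : set G :=
  let M := setmul mul in
  let I := setinv inv A in
  M (M (M (M (M (M (M (M (M I A) I) I) A) I) A) A) I) A.

(* Main.v *)
Require Import Defs.
From mathcomp Require Import all_boot all_order all_algebra.
From mathcomp Require Import all_classical all_reals all_analysis.
From mathcomp Require Import Rstruct Rstruct_topology.
From mathcomp Require Import lra.
Import Order.TTheory GRing.Theory Num.Theory.
Local Open Scope classical_set_scope.
Local Open Scope ring_scope.

Set Implicit Arguments.
Unset Strict Implicit.
Unset Printing Implicit Defensive.

(** Diagonal conjugation of tuples by an element of [G] preserves [d].
    Ample generics, together with lower semi-continuity of [d], give: for a
    generic tuple and any nearby generic tuple there is a conjugator close to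
    [1] moving one within any prescribed error of the other. With
    Kuratowski-Ulam this produces a Cantor scheme of conjugators
    [h : 2^N -> G], continuous, such that whenever [a] and [b] first differ at
    level [n], with [a n = 0] and [b n = 1], the conjugate of some point of
    [P_n] by [h a] is close to the conjugate of some point of [Q_n] by [h b];
    here [P_n] has to be non-meagre, and [Q_n] non-meagre in every neighbourhood of
    every point of [P_n].

    If the conclusion fails, pick for each non-meagre [A_m] an element [g]
    close to [1] outside the [eps]-neighbourhood of the word set, and let [P],
    [Q] be [A_m^-1] and [g A_m^-1], near a common point. Some translate of
    [h] meets the cover generically, so by Baire category on [2^N] there are
    [a], [b] in the same piece [k_m A_m] which split at a level devoted to [m].
    Then [(h b)^-1 (h a)] is in [A_m^-1 A_m], and [g] is close to
    [A_m^-1 A_m A_m^-1 A_m^-1 A_m A_m], a subset of the word set: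
    a contradiction. *)

(** * Baire category *)

Section category.
Context {T : topologicalType}.
Implicit Types A B E O : set T.

Lemma sub_meagre A B : A `<=` B -> meagre B -> meagre A.
Proof. by move=> AB [F [nF BF]]; exists F; split=> // x /AB/BF. Qed.

Lemma sub_comeagre A B : A `<=` B -> comeagre A -> comeagre B.
Proof. by move=> AB; apply: sub_meagre => x nBx /AB. Qed.

Lemma meagre_bigcup (F : nat -> set T) :
  (forall n, meagre (F n)) -> meagre (\bigcup_n F n).
Proof.
move=> /choice[N NF].
exists (fun k => if unpickle k is Some p then N p.1 p.2 else set0); split.
  move=> k; case: unpickle => [p|]; first exact: (NF p.1).1.
  by rewrite /nowhere_dense closure0 interior0.
move=> x [n _ /((NF n).2)[m _ Nnm]].
by exists (pickle (n, m)) => //; rewrite pickleK.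
Qed.

Lemma meagre0 : meagre (set0 : set T).
Proof.
exists (fun=> set0); split=> // _.
by rewrite /nowhere_dense closure0 interior0.
Qed.

Lemma meagreU A B : meagre A -> meagre B -> meagre (A `|` B).
Proof.
move=> mA mB; have : meagre (\bigcup_n (if n is 0%N then A else B)).
  by apply: meagre_bigcup => -[].
by apply: sub_meagre => x [Ax|Bx]; [exists 0%N|exists 1%N].
Qed.

Lemma nowhere_dense_meagre A : nowhere_dense A -> meagre A.
Proof. by move=> nA; exists (fun=> A); split=> // x Ax; exists 0%N. Qed.

Lemma comeagre_bigcap (F : nat -> set T) :
  (forall n, comeagre (F n)) -> comeagre (\bigcap_n F n).
Proof. by move=> cF; rewrite /comeagre setC_bigcap; exact: meagre_bigcup. Qed.

Lemma comeagreI A B : comeagre A -> comeagre B -> comeagre (A `&` B).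
Proof. by move=> cA cB; rewrite /comeagre setCI; exact: meagreU. Qed.

Lemma comeagreT : comeagre [set: T].
Proof. by rewrite /comeagre setCT; exact: meagre0. Qed.

Lemma comeagre_forall (I : countType) (F : I -> set T) :
  (forall i, comeagre (F i)) -> comeagre [set x | forall i, F i x].
Proof.
move=> cF.
have := @comeagre_bigcap (fun n => if unpickle n is Some i then F i else setT).
move=> /(_ _)/sub_comeagre; apply.
  by move=> x Fx i; have := Fx (pickle i) Logic.I; rewrite /= pickleK.
by move=> n; case: unpickle => //; exact: comeagreT.
Qed.

Lemma dense_setC_closure A : nowhere_dense A -> dense (~` closure A).
Proof.
move=> nA O [x Ox] oO; apply/set0P/negP => /eqP O0.
suff : interior (closure A) x by rewrite nA.
apply: filterS (open_nbhs_nbhs (conj oO Ox)) => y Oy; apply: contrapT => Ay.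
by rewrite -[False]/(set0 y) -O0.
Qed.

Lemma open_dense_comeagre A : open A -> dense A -> comeagre A.
Proof.
move=> oA dA; apply: nowhere_dense_meagre; rewrite /nowhere_dense.
rewrite -(proj1 (closure_id _) (open_closedC oA)) -subset0 => x Ax.
have [|y [Ay]] := dA (interior (~` A)) _ (open_interior _); first by exists x.
by move: Ay => /interior_subset.
Qed.

Lemma comeagreP A : comeagre A <->
  exists2 U : nat -> set T, (forall n, open (U n) /\ dense (U n)) &
    \bigcap_n U n `<=` A.
Proof.
split=> [[F [nF AF]]|[U oU UA]].
  exists (fun n => ~` closure (F n)) => [n|x Fx].
    by split; [exact/closed_openC/closed_closure|exact: dense_setC_closure].
  apply: contrapT => /AF[n _ Fnx]; exact: (Fx n Logic.I (subset_closure Fnx)).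
apply: sub_comeagre UA _; apply: comeagre_bigcap => n.
by have [? ?] := oU n; exact: open_dense_comeagre.
Qed.

(** The points at which [A] is locally of second category. Under a countable base it is a closed
    hull of [A] up to a meagre set, even if [A] lacks the Baire property. *)
Definition ess_support A : set T :=
  [set x | forall O, nbhs x O -> ~ meagre (A `&` O)].

Lemma closed_ess_support A : closed (ess_support A).
Proof.
rewrite -openC openE => x /existsNP[ O /not_implyP[xO /contrapT mO]].
apply: filterS (nbhs_interior xO) => y yO /(_ _ yO); exact.
Qed.

End category.

Lemma comeagre_preimage (T U : topologicalType) (f : T -> U) (g : U -> T)
    (E : set U) : continuous f -> continuous g -> cancel f g -> cancel g f ->
  comeagre E -> comeagre (f @^-1` E).
Proof.
move=> cf cg fK gK /comeagreP[W oW WE]; apply/comeagreP.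
exists (fun n => f @^-1` W n) => [n|x Wx]; last by apply: WE => n _; exact: Wx.
have [oWn dWn] := oW n.
split; first by apply: open_comp => // x _; exact: cf.
move=> O [x Ox] oO.
have [||u [Ou Wu]] := dWn (g @^-1` O).
- by exists (f x); rewrite /= fK.
- by apply: open_comp => // u _; exact: cg.
- by exists (g u); split => //=; rewrite gK.
Qed.

Lemma meagre_preimage (T U : topologicalType) (f : T -> U) (g : U -> T)
    (E : set U) : continuous f -> continuous g -> cancel f g -> cancel g f ->
  meagre E -> meagre (f @^-1` E).
Proof.
move=> cf cg fK gK mE.
have := comeagre_preimage (E := ~` E) cf cg fK gK.
by rewrite /comeagre setCK preimage_setC setCK; exact.
Qed.

Definition countable_base (T : topologicalType) (B : nat -> set T) :=
  (forall n, open (B n)) /\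
  forall x O, nbhs x O -> exists2 n, B n x & B n `<=` O.

(** Banach category theorem, second countable case: a point of [A] off the support lies in one of
    the countably many basic open sets that meet [A] in a meagre set. *)
Lemma meagre_setD_ess_support (T : topologicalType) (B : nat -> set T) (A : set
  T) :
  countable_base B -> meagre (A `\` ess_support A).
Proof.
move=> [oB bB].
pose N n := [set x | meagre (A `&` B n) /\ (A `&` B n) x].
have : meagre (\bigcup_n N n).
  apply: meagre_bigcup => n; have [mA|mA] := pselect (meagre (A `&` B n)).
    by apply: sub_meagre mA => x [].
  by apply: sub_meagre meagre0 => x [].
apply: sub_meagre => x [Ax /existsNP[ O /not_implyP[/bB[n Bnx BnO] /contrapT
  mO]]].
exists n => //; split=> //; apply: sub_meagre mO => y [Ay /BnO]; by [].
Qed.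

(* Kuratowski-Ulam *)
Lemma comeagre_section (X Y : topologicalType) (B : nat -> set Y)
    (E : set (X * Y)) : countable_base B -> comeagre E ->
  comeagre [set x | comeagre [set y | E (x, y)]].
Proof.
move=> [oB bB] /comeagreP[U oU UE].
(* A section of [U n] is dense once it meets every nonempty [B i], so countably many conditions on
   [x] suffice. *)
pose V n i := [set x | B i !=set0 -> exists2 y, B i y & U n (x, y)].
have cV n i : comeagre (V n i).
  have [[y0 By0]|B0] := pselect (B i !=set0); last first.
    by apply: sub_comeagre comeagreT => x _ /B0.
  have [oUn dUn] := oU n; apply: open_dense_comeagre.
    rewrite openE => x /(_ (ex_intro _ _ By0))[y By Uxy].
    have [[P Q] [Px Qy] PQU] : nbhs (x, y) (U n) by exact: open_nbhs_nbhs.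
    apply: filterS Px => x' Px' _; exists y => //; apply: PQU; split => //=.
    exact: nbhs_singleton.
  move=> O [x Ox] oO.
  have [||[x' y'] [[/= Ox' By'] Uxy]] := dUn (O `*` B i).
  - by exists (x, y0).
  - rewrite openE => -[x' y'] [/= Ox' By']; exists (O, B i) => //=.
    by split; exact: open_nbhs_nbhs.
  - by exists x'; split => // _; exists y'.
have : comeagre (\bigcap_n \bigcap_i V n i).
  by apply: comeagre_bigcap => n; exact: comeagre_bigcap.
apply: sub_comeagre => x Vx; apply/comeagreP.
exists (fun n => [set y | U n (x, y)]) => [n|y Uy]; last first.
  by apply: UE => n _; exact: Uy.
have [oUn dUn] := oU n; split.
  rewrite openE => y Uxy.
  have [[P Q] [Px Qy] PQU] : nbhs (x, y) (U n) by exact: open_nbhs_nbhs.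
  by apply: filterS Qy => y' Qy'; apply: PQU; split => //=;
    exact: nbhs_singleton.
move=> O [y Oy] oO; have [i Biy BiO] := bB y O (open_nbhs_nbhs (conj oO Oy)).
have [|y' By' Uy'] := Vx n Logic.I i Logic.I; first by exists y.
by exists y'; split => //; exact: BiO.
Qed.

(* The scheme is the one of Nikodym's theorem on the Suslin operation. *)
Lemma comeagre_scheme (T : topologicalType) (B : nat -> set T)
    (C : seq nat -> set T) : countable_base B ->
  (forall s, C s `<=` \bigcup_i C (i :: s)) ->
  comeagre [set x | forall s,
    [/\ C s x -> ess_support (C s) x,
      ess_support (C s) x -> interior (ess_support (C s)) x &
        ess_support (C s) x -> exists i, ess_support (C (i :: s)) x]].
Proof.
move=> bB Csplit; apply: comeagre_forall => s.
pose K1 := ~` (C s `\` ess_support (C s)).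
pose K2 := ~` (ess_support (C s) `\` interior (ess_support (C s))).
pose K3 := ~` (ess_support (C s) `\` \bigcup_i ess_support (C (i :: s))).
suff : comeagre (K1 `&` (K2 `&` K3)).
  apply: sub_comeagre => x [k1 [k2 k3]]; split.
  - by move=> Cx; apply: contrapT => ?; exact: k1.
  - by move=> Cx; apply: contrapT => ?; exact: k2.
  - move=> Cx; apply: contrapT => Ci; apply: k3; split=> // -[i _ Di].
    by apply: Ci; exists i.
apply: comeagreI; last apply: comeagreI; rewrite /comeagre setCK.
- exact: meagre_setD_ess_support bB.
- apply: nowhere_dense_meagre; rewrite /nowhere_dense -subset0 => x.
  set D := ess_support _; rewrite /interior nbhsE => -[ O [oO Ox] OD].
  have cD : closed (D `\` D°) by apply: closedI;
    [exact: closed_ess_support|exact/open_closedC/open_interior].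
  rewrite -(proj1 (closure_id _) cD) in OD.
  have [_] := OD _ Ox; apply; apply: filterS (open_nbhs_nbhs (conj oO Ox)).
  by move=> y /OD[].
- apply: nowhere_dense_meagre; rewrite /nowhere_dense -subset0 => x.
  rewrite {1}/interior nbhsE => -[ O [oO Ox] OD].
  have [y [[Dy nDy] Oy]] := OD _ Ox _ (open_nbhs_nbhs (conj oO Ox)).
  apply: (Dy O); first exact: open_nbhs_nbhs.
  (* This set covers [C s] within [O], against the choice of [y]. It is meagre since each
     [ess_support (C (i :: s))] is nowhere dense in [O], being closed and disjoint from a set whose
     closure contains [O]. *)
  have : meagre (\bigcup_i ((C (i :: s) `\` ess_support (C (i :: s))) `|`
                            (O `&` ess_support (C (i :: s))))).
    apply: meagre_bigcup => i; apply: meagreU.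
      exact: meagre_setD_ess_support bB.
    apply: nowhere_dense_meagre; rewrite /nowhere_dense -subset0 => z.
    rewrite {1}/interior nbhsE => -[W [oW Wz] WD].
    have [z' [[Oz' _] Wz']] := WD _ Wz _ (open_nbhs_nbhs (conj oW Wz)).
    have [z'' [[_ nD] [Oz'' Wz'']]] :=
      OD _ Oz' _ (open_nbhs_nbhs (conj (openI oO oW) (conj Oz' Wz'))).
    apply: nD; exists i => //; have := WD _ Wz''.
    have := @closed_ess_support _ (C (i :: s)) => /closure_id {2}->.
    by apply: closureS => ? [].
  apply: sub_meagre => z [/Csplit[i _ Ciz] Oz]; exists i => //.
  by have [?|?] := pselect (ess_support (C (i :: s)) z); [right|left].
Qed.

(** * Finite powers of a space *)

Lemma nbhs_tupleGP (G : topologicalType) n (x : tupleG G n)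
    (O : set (tupleG G n)) :
  nbhs x O <-> exists2 N : 'I_n -> set G, (forall i, nbhs (x i) (N i)) &
    [set y : tupleG G n | forall i, N i (y i)] `<=` O.
Proof.
split; last first.
  move=> [N xN NO]; apply: filterS NO _.
  apply: (@filter_forall _ _ (fun i (y : tupleG G n) => N i (y i)) (nbhs x)).
  by move=> i; exact: (@proj_continuous _ (fun=> G) i x (N i) (xN i)).
pose F : set_system (tupleG G n) := [set O |
  exists2 N : 'I_n -> set G, (forall i, nbhs (x i) (N i)) &
    [set y : tupleG G n | forall i, N i (y i)] `<=` O].
have FF : Filter F.
  split.
  - by exists (fun=> setT) => // i; exact: filterT.
  - move=> P Q [N xN NP] [M xM MQ]; exists (fun i => N i `&` M i).
      by move=> i; exact: filterI.
    by move=> y Ny; split; [apply: NP|apply: MQ] => i; have [] := Ny i.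
  - by move=> P Q PQ [N xN NP]; exists N => // y /NP/PQ.
suff : F --> x by apply.
apply/cvg_sup => i A [_ [[B oB <-] /= Bx BA]].
exists (fun j => if j == i then B else setT).
  move=> j; case: eqP => [->|_]; last exact: filterT.
  exact: open_nbhs_nbhs.
by move=> y /(_ i); rewrite eqxx => By; exact: BA.
Qed.

Lemma countable_base_tupleG (G : topologicalType) (B : nat -> set G) n :
  countable_base B -> exists C, @countable_base (tupleG G n) C.
Proof.
move=> [oB bB].
exists (fun k => if unpickle k is Some f then
  [set y : tupleG G n | forall i, B ((f : {ffun 'I_n -> nat}) i) (y i)]
  else set0); split.
  move=> k; case: unpickle => [f|]; last exact: open0.
  rewrite openE => x Bx; apply/nbhs_tupleGP; exists (fun i => B (f i)) => // i.
  exact: open_nbhs_nbhs.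
move=> x O /nbhs_tupleGP[N xN NO].
have /choice[f Hf] : forall i, exists k, B k (x i) /\ B k `<=` N i.
  by move=> i; have [k] := bB _ _ (xN i); exists k.
exists (pickle (finfun f)); rewrite pickleK.
  by move=> i; rewrite ffunE; exact: (Hf i).1.
by move=> y By; apply: NO => i; apply: (Hf i).2; have := By i; rewrite ffunE.
Qed.

Section tuple_cons.
Context {G : topologicalType}.

Definition tupleG_cons n (p : tupleG G n * G) : tupleG G n.+1 :=
  fun i => if unlift ord0 i is Some j then p.1 j else p.2.

Definition tupleG_uncons n (x : tupleG G n.+1) : tupleG G n * G :=
  (fun j => x (lift ord0 j), x ord0).

Definition tupleG_seq n (x : tupleG G n) : seq G := [seq x i | i <- enum 'I_n].

Lemma tupleG_consK n : cancel (@tupleG_cons n) (@tupleG_uncons n).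
Proof.
move=> [x z]; rewrite /tupleG_uncons /tupleG_cons unlift_none /=.
by congr pair; apply/funext => j; rewrite liftK.
Qed.

Lemma tupleG_unconsK n : cancel (@tupleG_uncons n) (@tupleG_cons n).
Proof.
move=> x; apply/funext => i; rewrite /tupleG_uncons /tupleG_cons /=.
by case: unliftP => [j|] ->.
Qed.

Lemma continuous_tupleG_cons n : continuous (@tupleG_cons n).
Proof.
move=> [x z] O /nbhs_tupleGP[N xN NO].
exists ([set y : tupleG G n | forall j, N (lift ord0 j) (y j)], N ord0) => /=.
  split.
    apply/nbhs_tupleGP; exists (fun j => N (lift ord0 j)) => // j.
    by have := xN (lift ord0 j); rewrite /tupleG_cons liftK.
  by have := xN ord0; rewrite /tupleG_cons unlift_none.
move=> [y w] [/= Ny Nw]; apply: NO => i; rewrite /tupleG_cons /=.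
by case: unliftP => [j|] ->.
Qed.

Lemma continuous_tupleG_uncons n : continuous (@tupleG_uncons n).
Proof.
move=> x O [[P Q] [/= /nbhs_tupleGP[N xN NP] Qx] PQO].
apply/nbhs_tupleGP.
exists (fun i => if unlift ord0 i is Some j then N j else Q).
  by move=> i; case: unliftP => [j|] ->; [exact: xN|exact: Qx].
move=> y Ny; apply: PQO; split=> /=.
  by apply: NP => j; have := Ny (lift ord0 j); rewrite liftK.
by have := Ny ord0; rewrite unlift_none.
Qed.

Lemma size_tupleG_seq n (x : tupleG G n) : size (tupleG_seq x) = n.
Proof. by rewrite size_map size_enum_ord. Qed.

Lemma tupleG_seq_cons n (x : tupleG G n) z :
  tupleG_seq (tupleG_cons (x, z)) = z :: tupleG_seq x.
Proof.
rewrite /tupleG_seq enum_ordSl /= {1}/tupleG_cons unlift_none /= -map_comp.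
congr (_ :: _); apply: eq_map => j.
by rewrite /= /tupleG_cons liftK.
Qed.

(* Witness: [good s] holds if for every k, for generic z_1, then generic z_2,
   ..., then generic z_k, the sequence [z_k :: ... :: z_1 :: s] satisfies [E].
     *)
Lemma comeagre_good_seq (B : nat -> set G) (E : seq G -> Prop) :
  countable_base B ->
  (forall n, comeagre [set x : tupleG G n | E (tupleG_seq x)]) ->
  exists good : seq G -> Prop, [/\ good [::],
    forall s, good s -> comeagre [set z | good (z :: s)] &
    forall s, good s -> E s].
Proof.
move=> bB cE.
pose Q k := iter k (fun (P : seq G -> Prop) s => comeagre [set z | P (z :: s)])
  E.
have cQ k n : comeagre [set x : tupleG G n | Q k (tupleG_seq x)].
  elim: k n => [|k IHk] n; first exact: cE.
  have := comeagre_preimage (@continuous_tupleG_cons n)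
    (@continuous_tupleG_uncons n) (@tupleG_consK n) (@tupleG_unconsK n) (IHk
      n.+1).
  move=> /(comeagre_section bB); apply: sub_comeagre => x.
  by apply: sub_comeagre => z /=; rewrite tupleG_seq_cons.
exists (fun s => forall k, Q k s); split.
(* The space of [0]-tuples is a single point, so a comeagre subset of it is not empty. *)
- move=> k; apply: contrapT => nQ; have [F [nF FQ]] := cQ k 0%N.
  pose x0 : tupleG G 0 := fun i => False_rect G (notF (ltn_ord i)).
  have x0E (x : tupleG G 0) : x = x0 by apply/funext => -[].
  have [|i _ Fi] := FQ x0; first by move=> /=; rewrite /tupleG_seq enum_ord0.
  have := nF i; rewrite /nowhere_dense (_ : closure _ = setT).
    by rewrite interiorT => /seteqP[/(_ x0 Logic.I)].
  by apply/seteqP; split => // x _; rewrite (x0E x); exact: subset_closure.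
- move=> s gs; have := comeagre_bigcap (fun k => gs k.+1).
  by apply: sub_comeagre => z Qz k; exact: Qz.
- by move=> s /(_ 0%N).
Qed.

End tuple_cons.

(** * Complete metrics and the Cantor space *)

Local Notation R := Rdefinitions.R.

Lemma invS_gt0 n : 0 < (n.+1%:R^-1 : R).
Proof. by rewrite invr_gt0 ltr0n. Qed.

Lemma invS_lt (e : R) : 0 < e -> exists N, forall n,
  (N <= n)%N -> n.+1%:R^-1 < e.
Proof.
move=> /ltr_add_invr[N]; rewrite add0r => Ne; exists N => n Nn.
by apply: le_lt_trans Ne; rewrite lef_pV2 ?posrE ?ltr0n // ler_nat ltnS.
Qed.

Section metric.
Context (T : topologicalType) (r : T -> T -> R).
Hypothesis mr : is_metric r.

Lemma metricxx x : r x x = 0. Proof. by case: mr => r0 _ _; exact/r0. Qed.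

Lemma metricC x y : r x y = r y x. Proof. by case: mr. Qed.

Lemma metric_triangle y x z : r x z <= r x y + r y z.
Proof. by case: mr => _ _; exact. Qed.

Hypothesis ir : metric_induces_topology r.

Lemma open_dball x (e : R) : open (dball r x e).
Proof.
apply/ir => y xy; exists (e - r x y); first by rewrite subr_gt0.
by move=> z; rewrite /dball /=; have := metric_triangle y x z; lra.
Qed.

Lemma nbhs_dball x (e : R) : 0 < e -> nbhs x (dball r x e).
Proof.
by move=> e0; apply: open_nbhs_nbhs; split;
  [exact: open_dball|rewrite /dball /= metricxx].
Qed.

Lemma nbhs_dballP x (O : set T) :
  nbhs x O <-> exists2 e : R, 0 < e & dball r x e `<=` O.
Proof.
split=> [|[e e0]]; last by move=> eO; apply: filterS eO _; exact: nbhs_dball.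
by rewrite nbhsE => -[U [/ir oU Ux] UO]; have [e e0 eU] := oU x Ux;
  exists e => // y /eU/UO.
Qed.

Lemma metric_countable_base : separable_space T ->
  exists B : nat -> set T, countable_base B.
Proof.
move=> [u du].
exists (fun k => if unpickle k is Some p then dball r (u p.1) p.2.+1%:R^-1 else
  set0).
split=> [k|x O /nbhs_dballP[e e0 eO]].
  by case: unpickle => [p|]; [exact: open_dball|exact: open0].
have [|j je] := @invS_lt (e / 2); first by rewrite divr_gt0.
have [|| y0 [xi [i _ iy0]]] := du (dball r x j.+1%:R^-1).
- by exists x; rewrite /dball /= metricxx invS_gt0.
- exact: open_dball.
subst y0; exists (pickle (i, j)); rewrite pickleK /=;
  first by rewrite /dball /= metricC.
move=> y iy; apply: eO; move: xi iy (je j (leqnn j)) (metric_triangle (u i) x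
  y).
by rewrite /dball /=; move: (j.+1%:R^-1) => a; lra.
Qed.

Lemma baire (E : set T) : metric_complete r -> comeagre E -> dense E.
Proof.
move=> cr /comeagreP[U oU UE] O [x0 Ox0] oO.
(* Each step shrinks to a closed ball inside [U n] and inside the previous open ball. The premise
   [0 < p.2] lets the choice function be total. *)
have step n (p : T * R) : exists q : T * R, 0 < p.2 -> [/\ 0 < q.2,
    q.2 <= n.+1%:R^-1, r p.1 q.1 < p.2 &
    forall z, r q.1 z <= q.2 -> U n z /\ r p.1 z < p.2].
  have [p0|] := pselect (0 < p.2); last by exists p.
  have [oUn dUn] := oU n.
  have [||y [py Uy]] := dUn (dball r p.1 p.2); last first.
  - have /ir/(_ y (conj py Uy))[e e0 eS] : open (dball r p.1 p.2 `&` U n).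
      by apply: openI => //; exact: open_dball.
    exists (y, Num.min (e / 2) n.+1%:R^-1) => _ /=; split=> //.
    + by rewrite lt_min divr_gt0 ?invS_gt0.
    + by rewrite ge_min lexx orbT.
    + by move=> z; rewrite le_min => /andP[ze _]; have [|] := eS z => //;
      rewrite /dball /=; lra.
  - exact: open_dball.
  - by exists p.1; rewrite /dball /= metricxx.
have /choice[F FP] : forall np : nat * (T * R), exists q : T * R, 0 < np.2.2 ->
    [/\ 0 < q.2, q.2 <= np.1.+1%:R^-1, r np.2.1 q.1 < np.2.2 &
    forall z, r q.1 z <= q.2 -> U np.1 z /\ r np.2.1 z < np.2.2].
  by move=> [n p]; exact: step.
have /ir/(_ x0 Ox0)[e0 e00 eO] := oO.
pose fix p n := if n is n'.+1 then F (n', p n') else (x0, e0 / 2).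
have p0 n : 0 < (p n).2.
  by elim: n => [|n IHn] /=; [rewrite divr_gt0|have [] := FP (n, p n) IHn].
have pS n : [/\ (p n.+1).2 <= n.+1%:R^-1 & forall z,
    r (p n.+1).1 z <= (p n.+1).2 -> U n z /\ r (p n).1 z < (p n).2].
  by have [] := FP (n, p n) (p0 n).
have nest n k z : r (p (n + k)%N).1 z <= (p (n + k)%N).2 -> r (p n).1 z <= (p
  n).2.
  elim: k => [|k IHk]; first by rewrite addn0.
  rewrite addnS => zk; apply: IHk; have [_ /(_ z zk)[_ /ltW]] := pS (n + k)%N;
    exact.
have pin n m : (n <= m)%N -> r (p n).1 (p m).1 <= (p n).2.
  by move=> /subnKC <-; apply: (nest n (m - n)%N); rewrite metricxx; exact/ltW.
have [e e_gt0|x Hx] := cr (fun n => (p n).1).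
  have [|N Ne] := @invS_lt (e / 2); first by rewrite divr_gt0.
  exists N.+1 => m n Nm Nn; have [+ _] := pS N.
  move: (pin _ _ Nm) (pin _ _ Nn) (Ne _ (leqnn N)).
  have := metric_triangle (p N.+1).1 (p m).1 (p n).1;
    rewrite (metricC (p m).1 (p N.+1).1).
  by move: (N.+1%:R^-1) (p N.+1) => a b; lra.
have px n : r (p n).1 x <= (p n).2.
  apply/ler_addgt0Pr => e e_gt0; have [N NP] := Hx e e_gt0.
  have := metric_triangle (p (maxn N n)).1 (p n).1 x.
  have := pin n (maxn N n) (leq_maxr _ _); have :=
    NP (maxn N n) (leq_maxl _ _); lra.
exists x; split.
  by apply: eO; have := px 0%N; rewrite /dball /=; lra.
by apply: UE => n _; have [_ /(_ x (px n.+1))[]] := pS n.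
Qed.

End metric.

(** Baire category in [2^N] in terms of prefixes: the hypothesis makes the interior of each [D i]
    dense. Stage [k] lengthens the prefix and settles the condition with code [k]. *)
Lemma cantor_baire (I : countType) (D : I -> set (nat -> bool)) :
  (forall i a n, exists b N, (forall j, (j < n)%N -> b j = a j) /\
    forall c, (forall j, (j < N)%N -> c j = b j) -> D i c) ->
  exists a, forall i, D i a.
Proof.
move=> HD.
have /choice[F FP] : forall kp : nat * ((nat -> bool) * nat),
    exists q : (nat -> bool) * nat, [/\ (kp.2.2 < q.2)%N,
      forall j, (j < kp.2.2)%N -> q.1 j = kp.2.1 j &
      if unpickle kp.1 is Some i then
        forall c, (forall j, (j < q.2)%N -> c j = q.1 j) -> D i c else True].
  move=> [k [a n]] /=; case: (unpickle k) => [i|]; last by exists (a, n.+1).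
  have [b [N [ba bD]]] := HD i a n; exists (b, maxn N n.+1); split=> //=.
    exact: leq_maxr.
  by move=> c cb; apply: bD => j jN; apply: cb; rewrite leq_max jN.
pose fix p k := if k is k'.+1 then F (k', p k') else (fun=> false, 0%N).
have pS k : ((p k).2 < (p k.+1).2)%N /\
    forall j, (j < (p k).2)%N -> (p k.+1).1 j = (p k).1 j.
  by have [] := FP (k, p k).
have pk k : (k <= (p k).2)%N.
  by elim: k => // k IHk; apply: leq_ltn_trans IHk _; have [] := pS k.
have agree k m j : (j < (p k).2)%N ->
    (j < (p (k + m)%N).2)%N /\ (p (k + m)%N).1 j = (p k).1 j.
  move=> jk; elim: m => [|m [jm IHm]]; first by rewrite addn0.
  rewrite addnS; have [km kmE] := pS (k + m)%N.
  by split; [exact: ltn_trans km|rewrite kmE].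
exists (fun j => (p j.+1).1 j) => i.
have [_ _] := FP (pickle i, p (pickle i)); rewrite pickleK /=; apply.
move=> j jk; change ((p j.+1).1 j = (p (pickle i).+1).1 j).
have [/subnKC <-|/ltnW/subnKC <-] := leqP j.+1 (pickle i).+1.
  by have [_ ->] := agree j.+1 ((pickle i).+1 - j.+1)%N j (pk j.+1).
by have [_ <-] := agree (pickle i).+1 (j.+1 - (pickle i).+1)%N j jk.
Qed.

(** This allots to each [m] arbitrarily deep levels of the Cantor scheme. *)
Lemma logn2_surj m n : exists2 k, (n <= k)%N & logn 2 k = m.
Proof.
exists (2 ^ m * n.*2.+1)%N.
  apply: leq_trans (leq_pmull _ _); last by rewrite expn_gt0.
  by rewrite -addnn -addnS leq_addr.
rewrite lognM ?expn_gt0 // lognX (_ : logn 2 2 = 1)%N // muln1.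
by rewrite logn_coprime ?addn0 // coprime2n /= odd_double.
Qed.

(** * Topometric groups *)

Section topometric.
Context (G : topologicalType) (mul : G -> G -> G) (inv : G -> G) (idG : G)
  (d : G -> G -> R).
Hypothesis HG : polish_topometric_group mul inv idG d.

Local Notation "x ⋅ y" := (mul x y) (at level 40, left associativity).
Local Notation "x ^-" := (inv x) (at level 2, format "x ^-").

Definition conjg f x := f ⋅ x ⋅ f^-.

Let mulA x y z : x ⋅ (y ⋅ z) = x ⋅ y ⋅ z. Proof. by case: HG => -[[]]. Qed.
Let mul1g x : idG ⋅ x = x. Proof. by case: HG => -[[]]. Qed.
Let mulg1 x : x ⋅ idG = x. Proof. by case: HG => -[[]]. Qed.
Let mulVg x : x^- ⋅ x = idG. Proof. by case: HG => -[[]]. Qed.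
Let mulgV x : x ⋅ x^- = idG. Proof. by case: HG => -[[]]. Qed.

Let mulKg x y : x^- ⋅ (x ⋅ y) = y. Proof. by rewrite mulA mulVg mul1g. Qed.
Let mulKVg x y : x ⋅ (x^- ⋅ y) = y. Proof. by rewrite mulA mulgV mul1g. Qed.
Let mulgK x y : y ⋅ x ⋅ x^- = y. Proof. by rewrite -mulA mulgV mulg1. Qed.
Let mulgKV x y : y ⋅ x^- ⋅ x = y. Proof. by rewrite -mulA mulVg mulg1. Qed.

Let mulgI x y z : x ⋅ y = x ⋅ z -> y = z.
Proof. by move=> /(congr1 (mul x^-)); rewrite !mulKg. Qed.

Let invM x y : (x ⋅ y)^- = y^- ⋅ x^-.
Proof. by apply: (@mulgI (x ⋅ y)); rewrite mulgV mulA mulgK mulgV. Qed.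

Let invK x : x^-^- = x.
Proof. by apply: (@mulgI x^-); rewrite mulgV mulVg. Qed.

Lemma conjgM f g x : conjg (f ⋅ g) x = conjg f (conjg g x).
Proof. by rewrite /conjg invM !mulA. Qed.

Let md : is_metric d. Proof. by case: HG. Qed.

Lemma dist_mull g x y : d (g ⋅ x) (g ⋅ y) = d x y.
Proof. by case: HG => _ _ []. Qed.

Lemma dist_mulr g x y : d (x ⋅ g) (y ⋅ g) = d x y.
Proof. by case: HG => _ _ []. Qed.

Lemma dist_conjg f x y : d (conjg f x) (conjg f y) = d x y.
Proof. by rewrite dist_mulr dist_mull. Qed.

Lemma continuous_mull g : continuous (mul g).
Proof.
move=> x; have [[_ cM _ _] _ _ _ _] := HG.
exact: (@continuous2_cvg _ _ _ _ (nbhs x) _ (fun=> g) id mul g x (cM (g, x))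
  (cvg_cst _) cvg_id).
Qed.

Lemma continuous_mulr g : continuous (mul^~ g).
Proof.
move=> x; have [[_ cM _ _] _ _ _ _] := HG.
exact: (@continuous2_cvg _ _ _ _ (nbhs x) _ id (fun=> g) mul x g (cM (x, g))
  cvg_id (cvg_cst _)).
Qed.

Lemma continuous_inv : continuous inv.
Proof. by case: HG => -[]. Qed.

Lemma continuous_conjg x : continuous (conjg^~ x).
Proof.
move=> f; have [[_ cM _ _] _ _ _ _] := HG.
apply: (@continuous2_cvg _ _ _ _ (nbhs f) _ (mul^~ x) inv mul _ _
  (cM (f ⋅ x, f^-))).
  exact: continuous_mulr.
exact: continuous_inv.
Qed.

(** Lower semi-continuity in the form used below: upper bounds on [d] survive limits in the
    topology, for which [d] need not be continuous. *)
Lemma dist_lsc x y e :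
  (forall P Q, nbhs x P -> nbhs y Q ->
    exists x' y', [/\ P x', Q y' & d x' y' <= e]) ->
  d x y <= e.
Proof.
move=> H; apply: contrapT => nxy.
have [_ _ _ _ lsc] := HG.
have : nbhs (x, y) (~` [set p : G * G | d p.1 p.2 <= e]).
  by apply: open_nbhs_nbhs; split => //; exact/closed_openC/lsc.
move=> [[P Q] [/= xP yQ] PQ]; have [x' [y' [Px' Qy' dxy']]] := H P Q xP yQ.
exact: (PQ (x', y') (conj Px' Qy')).
Qed.

(** * Local conjugacy of generic tuples *)

Context (r : G -> G -> R).
Hypotheses (mr : is_metric r) (ir : metric_induces_topology r)
  (cr : metric_complete r).

Hypothesis sepG : separable_space G.
Hypothesis Hamp : ample_generics mul inv d.

(* The set [K] of tuples near [S g], for a small set [S] of conjugators, need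
   not have the Baire property, so it may fail to be comeagre where it is
   non-meagre. Cutting [S] into countably many smaller pieces again and again,
   and applying lower semi-continuity of [d] at the limit of a nested sequence
   of pieces, shows that generically every point of [ess_support K] is near
   [v g] for some [v] in the closure of [S]. *)
Lemma locally_conjugate_tuples n (V : set G) (e : R) : nbhs idG V -> 0 < e ->
  exists2 E : set (tupleG G n), comeagre E &
    forall x, E x -> exists2 W, nbhs x W & forall y, E y -> W y ->
      exists2 f, V f & forall i, d (conjg f (y i)) (x i) <= e.
Proof.
move=> V1 e0; have [|g cg] := @Hamp n (e / 2); first by rewrite divr_gt0.
have [B bB] := metric_countable_base mr ir sepG.
have [C bC] := countable_base_tupleG n bB.
(* The quotient condition concerns closures because a limit of conjugators is only known to lie in
   the closure of a piece. *)
pose small m (A : set G) := (forall a b, A a -> A b -> r a b < m.+1%:R^-1) /\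
  (forall a b, closure A a -> closure A b -> V (a ⋅ b^-)).
pose piece m i : set G := if pselect (small m (B i)) then B i else set0.
pose fix S s := if s is i :: s' then S s' `&` piece (size s') i else setT.
have cover m k : exists i, piece m i k.
  have [[_ cM _ _] _ _ _ _] := HG.
  have cquot : continuous (fun p : G * G => p.1 ⋅ p.2^-).
    move=> p; apply: (@continuous2_cvg _ _ _ _ (nbhs p) _ fst (inv \o snd) mul
      _ _ (cM (p.1, p.2^-))).
      exact: cvg_fst.
    by apply: continuous_comp; [exact: cvg_snd|exact: continuous_inv].
  have : nbhs (k, k) ((fun p : G * G => p.1 ⋅ p.2^-) @^-1` V).
    by apply: cquot; rewrite /= mulgV.
  move=> [[P Q] [/= kP kQ] PQV].
  have [a a0 aP] := (nbhs_dballP mr ir _ _).1 kP.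
  have [b b0 bQ] := (nbhs_dballP mr ir _ _).1 kQ.
  pose c := Num.min (Num.min (a / 2) (b / 2)) (m.+1%:R^-1 / 2).
  have c0 : 0 < c by rewrite !lt_min !divr_gt0 ?invS_gt0.
  have [i Bik Bic] := bB.2 k _ (nbhs_dball mr ir k c0).
  have ca : c <= a / 2 by rewrite !ge_min lexx.
  have cb : c <= b / 2 by rewrite !ge_min lexx orbT.
  have cm : c <= m.+1%:R^-1 / 2 by rewrite !ge_min lexx orbT.
  have clB u : closure (B i) u -> r k u < c + c.
    move=> /(_ _ (nbhs_dball mr ir u c0))[v [/Bic]].
    by rewrite /dball /=; have := metric_triangle mr v k u;
      rewrite (metricC mr v u); lra.
  exists i; rewrite /piece; case: pselect => // -[];
    split=> [u v Bu Bv|u v Bu Bv].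
    have := Bic _ Bu; have := Bic _ Bv; rewrite /dball /=.
    have := metric_triangle mr k u v; rewrite (metricC mr u k).
    by move: cm; move: (m.+1%:R^-1) => t; lra.
  apply: (PQV (u, v)); split=> /=.
    by apply: aP; have := clB _ Bu; rewrite /dball /=; lra.
  by apply: bQ; have := clB _ Bv; rewrite /dball /=; lra.
pose K s : set (tupleG G n) :=
  [set x | exists2 v, S s v & forall i, d (x i) (conjg v (g i)) < e / 2].
have KS s : K s `<=` \bigcup_i K (i :: s).
  move=> x [v Sv xv]; have [i Piv] := cover (size s) v.
  by exists i => //; exists v.
pose E := K [::] `&` [set x | forall s,
    [/\ K s x -> ess_support (K s) x,
      ess_support (K s) x -> interior (ess_support (K s)) x &
        ess_support (K s) x -> exists i, ess_support (K (i :: s)) x]].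
(* A branch of pieces whose [K s] stay essential at [x] shrinks to a point [v]. Near [x] there are
   tuples close to conjugates of [g] by elements near [v], and [dist_lsc] carries the bound over to
   [x] and [v]. *)
have limit x i : E x -> ess_support (K [:: i]) x -> exists2 v,
    small 0 (B i) /\ closure (B i) v & forall j,
      d (x j) (conjg v (g j)) <= e / 2.
  move=> [_ Ex] xi.
  have /choice[nxt nxtP] : forall s, exists i,
    ess_support (K s) x -> ess_support (K (i :: s)) x.
    move=> s; have [_ _ Hs] := Ex s.
    by have [/Hs[j]|] := pselect (ess_support (K s) x); [exists j|exists 0%N].
  pose s m := iter m (fun s => nxt s :: s) [:: i].
  have sx m : ess_support (K (s m)) x by elim: m => // m /nxtP.
  have szs m : size (s m) = m.+1 by elim: m => //= m ->.
  have Ksx m W : nbhs x W -> exists2 y, K (s m) y & W y.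
    move=> xW; apply: contrapT => nKW; apply: (sx m W xW).
    by apply: sub_meagre meagre0 => y [Ky Wy]; apply: nKW; exists y.
  have Ssub m k : S (s (m + k)%N) `<=` S (s m).
    elim: k => [|k IHk]; first by rewrite addn0.
    by rewrite addnS => y [/IHk].
  have Spiece m y : S (s m) y -> exists t,
    piece m t y /\ S (s m) `<=` piece m t.
    case: m => [|m] /= [_ ty]; first by exists i; split=> // z [].
    by exists (nxt (s m)); rewrite -(szs m); split => // z [].
  have Sdiam m y z : S (s m) y -> S (s m) z -> r y z < m.+1%:R^-1.
    move=> Sy Sz; have [t [ty tS]] := Spiece m y Sy; have := tS z Sz.
    by move: ty; rewrite /piece; case: pselect => [sm ? ?|_ []]; exact: sm.1.
  have /choice[v vS] : forall m, exists v, S (s m) v.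
    by move=> m; have [y [v Sv _] _] := Ksx m setT filterT; exists v.
  have small0 : small 0 (B i).
    by have [_] := vS 0%N; rewrite /piece; case: pselect.
  have Spiece0 m : S (s m) `<=` B i.
    rewrite -[m]add0n => y /Ssub[_]; rewrite /piece; by case: pselect.
  have Sv m k : (m <= k)%N -> r (v m) (v k) < m.+1%:R^-1.
    by move=> /subnKC mk; apply: Sdiam => //; apply: (@Ssub m (k - m)%N);
      rewrite mk.
  have [eps eps0|w Hw] := cr (u := v).
    have [|N Ne] := @invS_lt (eps / 2); first by rewrite divr_gt0.
    exists N => m k Nm Nk; have := Ne N (leqnn N).
    have := Sv _ _ Nm; have := Sv _ _ Nk.
    have := metric_triangle mr (v N) (v m) (v k);
      rewrite (metricC mr (v m) (v N)).
    by move: (N.+1%:R^-1) => t; lra.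
  have Snear W : nbhs w W -> exists m, S (s m) `<=` W.
    move=> /(nbhs_dballP mr ir)[eps eps0 epsW].
    have [|N NP] := Hw (eps / 2); first by rewrite divr_gt0.
    have [|M MP] := @invS_lt (eps / 2); first by rewrite divr_gt0.
    exists (maxn N M) => y Sy; apply: epsW; rewrite /dball /=.
    have := NP _ (leq_maxl N M); have := MP _ (leq_maxr N M).
    have := Sdiam _ _ _ (vS (maxn N M)) Sy.
    have := metric_triangle mr (v (maxn N M)) w y; rewrite (metricC mr w (v _)).
    by move: ((maxn N M).+1%:R^-1) => t; lra.
  exists w; [split=> // W wW|move=> j].
    have [m mW] := Snear W wW; exists (v m); split; last exact/mW.
    exact/Spiece0/vS.
  apply: dist_lsc => P Q xP wQ.
  have [m mQ] := Snear _ (continuous_conjg wQ).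
  have xP' : nbhs x [set y : tupleG G n | P (y j)].
    exact: (@proj_continuous _ (fun=> G) j x P xP).
  have [y [u Su yu] Py] := Ksx m _ xP'.
  by exists (y j), (conjg u (g j)); split => //; [exact/mQ|exact/ltW/yu].
exists E.
  apply: comeagreI; last exact: comeagre_scheme bC KS.
  apply: sub_comeagre cg => x [_ [k ->] xk] /=; by exists k.
move=> x [Kx Ex]; have [i _ Kix] := KS [::] x Kx.
have [/(_ Kix) xi /(_ xi) Wx _] := Ex [:: i].
exists (interior (ess_support (K [:: i]))); first exact: nbhs_interior.
move=> y Ey /interior_subset yi.
have [v [sB Bv] xv] := limit x i (conj Kx Ex) xi.
have [w [_ Bw] yw] := limit y i Ey yi.
(* The tuples [x] and [y] are within [e / 2] of the conjugates of [g] by [v] and [w], both in the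
   closure of the same small piece. *)
exists (v ⋅ w^-); first exact: sB.2.
move=> j; have := dist_conjg (v ⋅ w^-) (y j) (conjg w (g j)).
rewrite -conjgM mulgKV.
have := metric_triangle md (conjg v (g j)) (conjg (v ⋅ w^-) (y j)) (x j).
by have := yw j; have := xv j; rewrite (metricC md (x j)); lra.
Qed.

(** The generic sets of [locally_conjugate_tuples], intersected over the errors [1/(j+1)], are
    passed to [comeagre_good_seq]. Two good sequences with the same tail [l] and close heads are
    close tuples, so the conjugator between them must almost fix [l]. *)
Lemma locally_conjugate_seqs : exists good : seq G -> Prop, [/\ good [::],
  forall l, good l -> comeagre [set z | good (z :: l)] &
  forall l z (V : set G) (e : R), good (z :: l) -> nbhs idG V -> 0 < e ->
    exists2 W, nbhs z W & forall w, W w -> good (w :: l) ->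
      exists f, [/\ V f, d (conjg f w) z <= e &
        forall t, t \in l -> d (conjg f t) t <= e]].
Proof.
have [B bB] := metric_countable_base mr ir sepG.
have exE (nj : nat * nat) : exists E : set (tupleG G nj.1),
    comeagre E /\ forall x, E x -> exists2 W, nbhs x W & forall y, E y -> W y ->
      exists2 f, dball r idG nj.2.+1%:R^-1 f &
        forall i, d (conjg f (y i)) (x i) <= nj.2.+1%:R^-1.
  case: nj => n j; have V1 := nbhs_dball mr ir idG (invS_gt0 j).
  by have [E cE EP] := locally_conjugate_tuples n V1 (invS_gt0 j); exists E.
pose E0 nj := sval (cid (exE nj)); have E0P nj := svalP (cid (exE nj)).
pose E l := exists n, exists2 x : tupleG G n,
  tupleG_seq x = l & forall j, E0 (n, j) x.
have [n|good [good0 goodS goodE]] := comeagre_good_seq bB (E := E).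
  have : comeagre [set x : tupleG G n | forall j, E0 (n, j) x].
    by apply: comeagre_forall => j; have [] := E0P (n, j).
  by apply: sub_comeagre => x Ex; exists n, x.
exists good; split=> // l z V e /goodE[n [x xl Ex]] V1 e0.
have [a a0 aV] := (nbhs_dballP mr ir _ _).1 V1.
have [j ja je] : exists2 j, j.+1%:R^-1 < a & j.+1%:R^-1 < e.
  have [N NP] := invS_lt a0; have [M MP] := invS_lt e0.
  by exists (maxn N M); [exact/NP/leq_maxl|exact/MP/leq_maxr].
have := E0P (n, j); move=> [_ /(_ x (Ex j))[W xW WP]].
case: n x xl Ex W xW WP => [|n] x xl Ex W xW WP.
  by move: xl; rewrite /tupleG_seq enum_ord0.
move: xl; rewrite -(tupleG_unconsK x);
  case: (tupleG_uncons x) (tupleG_unconsK x) => x' z' xE.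
rewrite tupleG_seq_cons => -[z'z x'l]; subst x z'.
have [[P Q] [/= x'P zQ] PQ] := continuous_tupleG_cons xW.
exists Q => // w Qw /goodE[m [y yl Ey]].
have mn : m = n.+1.
  by have := congr1 size yl; rewrite /= -x'l !size_tupleG_seq.
subst m; move: yl; rewrite -(tupleG_unconsK y).
case: (tupleG_uncons y) (tupleG_unconsK y) => y' w' yE.
rewrite tupleG_seq_cons => -[w'w y'l]; subst y w'.
have y'x' : y' = x'.
  apply/funext => i; move: y'l; rewrite -x'l => /eq_in_map; apply.
  by rewrite mem_enum.
subst y'.
have [|f fV fP] := WP _ (Ey j).
  by apply: PQ; split => //=; exact: nbhs_singleton.
exists f; split.
- by apply: aV; apply: lt_trans fV _.
- apply: le_trans (ltW je); have := fP ord0.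
  by rewrite /tupleG_cons unlift_none.
- move=> t; rewrite -x'l => /mapP[i _ ->]; apply: le_trans (ltW je).
  by have := fP (lift ord0 i); rewrite /tupleG_cons liftK.
Qed.

(** * Cantor scheme of conjugators *)

Lemma nonmeagre_meets (A E : set G) : ~ meagre A -> comeagre E ->
  exists2 x, A x & E x.
Proof.
move=> nA cE; apply: contrapT => AE; apply: nA; apply: sub_meagre cE => x Ax Ex.
by apply: AE; exists x.
Qed.

(* [h a] is the limit of conjugators [h_n] along the path [a]. At level [n] the
   two children of a node receive new points [z] of [P n] and [w] of [Q n]; the
   left child keeps [h_n] and the right one gets [h_n f], where [f] moves [w]
   close to [z] and almost fixes the points chosen earlier, so that
   later steps hardly move [conjg h_n z] and [conjg (h_n f) w]. *)
Lemma cantor_scheme (P Q : nat -> set G) (eps : nat -> R) :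
  (forall n, 0 < eps n) -> (forall n, ~ meagre (P n)) ->
  (forall n z W, P n z -> nbhs z W -> ~ meagre (Q n `&` W)) ->
  exists h : (nat -> bool) -> G,
    (forall a W, nbhs (h a) W -> exists N, forall b,
      (forall i, (i < N)%N -> b i = a i) -> W (h b)) /\
    (forall a b n, (forall i, (i < n)%N -> a i = b i) ->
      a n = false -> b n = true -> exists p q,
      [/\ P n p, Q n q & d (conjg (h a) p) (conjg (h b) q) < eps n]).
Proof.
move=> eps0 nP nQ.
have [good [good0 goodS goodP]] := locally_conjugate_seqs.
(* By halving, the errors made after level [n] sum to at most [dl n]. The final estimate adds three
   errors of at most [dl n]: one at the split and one along each path. Hence the quarter of
   [eps n]. *)
pose fix dl n : R :=
  if n is m.+1 then Num.min (dl m / 2) (eps n / 4) else eps 0%N / 4.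
have dl0 n : 0 < dl n.
  by elim: n => [|n IHn] /=; rewrite ?lt_min !divr_gt0.
have dleps n : dl n <= eps n / 4 by case: n => //= n; rewrite ge_min lexx orbT.
have dlS n : dl n.+1 <= dl n / 2 by rewrite /= ge_min lexx.
(* The move from level [n] to the next is at most [c n - c n.+1]; these bounds telescope, so the
   conjugators along a path are Cauchy for [r]. *)
pose c n : R := n.+1%:R^-1.
have c0 n : 0 < c n := invS_gt0 n.
have cS n : c n.+1 < c n by rewrite ltf_pV2 ?posrE ?ltr0n // ltr_nat.
have /choice[F FP] : forall nlh : nat * (seq G * G), exists zwf : G * G * G,
    let: (n, (l, h)) := nlh in let: (z, w, f) := zwf in good l ->
    [/\ P n z /\ Q n w, good (z :: l) /\ good (w :: l),
        r h (h ⋅ f) <= c n - c n.+1 &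
        d (conjg f w) z <= dl n /\
          forall t, t \in l -> d (conjg f t) t <= dl n].
  move=> [n [l h]]; have [gl|] := pselect (good l); last by exists (h, h, h).
  have [z Pz gz] := nonmeagre_meets (nP n) (goodS _ gl).
  (* Since [r] need not be left invariant, the neighbourhood allowed for [f] depends on [h]. *)
  have hV : nbhs idG (mul h @^-1` dball r h (c n - c n.+1)).
    apply: continuous_mull; rewrite mulg1; apply: (nbhs_dball mr ir).
    by rewrite subr_gt0.
  have [W zW WP] := goodP _ _ _ _ gz hV (dl0 n).
  have [w [Qw Ww] gw] := nonmeagre_meets (nQ n z W Pz zW) (goodS _ gl).
  have [f [hf fw ft]] := WP w Ww gw.
  by exists (z, w, f) => _; split=> //; exact/ltW.
pose next n (b : bool) (lh : seq G * G) : seq G * G :=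
  let: (z, w, f) := F (n, lh) in
  if b then (w :: lh.1, lh.2 ⋅ f) else (z :: lh.1, lh.2).
pose fix st (a : nat -> bool) n :=
  if n is m.+1 then next m (a m) (st a m) else ([::], idG).
have stP a n : good (st a n).1.
  elim: n => //= n; rewrite /next; have := FP (n, st a n).
  by case: (F _) => -[z w] f; case: (st a n) => l h /= Hl /Hl[_ [? ?] _ _];
    case: (a n).
have stE a b n : (forall i, (i < n)%N -> a i = b i) -> st a n = st b n.
  elim: n => //= n IHn ab; rewrite ab // IHn // => i /ltnW; exact: ab.
have st_step a n : r (st a n).2 (st a n.+1).2 <= c n - c n.+1 /\
    forall t, t \in (st a n).1 -> t \in (st a n.+1).1 /\
      d (conjg (st a n.+1).2 t) (conjg (st a n).2 t) <= dl n.
  have := FP (n, st a n); have := stP a n; rewrite /= /next.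
  case: (F _) => -[z w] f; case: (st a n) => l h /= gl /(_ gl)[_ _ hf [_ fl]].
  case: (a n) => /=.
    split=> // t tl; rewrite inE tl orbT; split=> //.
    by rewrite conjgM dist_conjg; exact: fl.
  split=> [|t tl]; first by rewrite metricxx // subr_ge0; exact/ltW.
  by rewrite inE tl orbT metricxx //; split=> //; exact/ltW.
have st_dist a n k : r (st a n).2 (st a (n + k)%N).2 <= c n - c (n + k)%N.
  elim: k => [|k IHk]; first by rewrite addn0 metricxx // subrr.
  rewrite addnS; have [+ _] := st_step a (n + k)%N.
  have := metric_triangle mr (st a (n + k)%N).2 (st a n).2 (st a (n + k).+1).2;
    lra.
have st_near a n m : (n <= m)%N -> r (st a n).2 (st a m).2 < c n.
  by move=> /subnKC <-; have := st_dist a n (m - n)%N;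
    have := c0 (n + (m - n))%N; lra.
have /choice[h hP] : forall a, exists x, forall e, 0 < e ->
    exists N, forall n, (N <= n)%N -> r (st a n).2 x < e.
  move=> a; apply: cr => e e0.
  have [|N Ne] := @invS_lt (e / 2); first by rewrite divr_gt0.
  exists N => m n Nm Nn; have := Ne N (leqnn N); rewrite -/(c N).
  have := st_near a _ _ Nm; have := st_near a _ _ Nn.
  have := metric_triangle mr (st a N).2 (st a m).2 (st a n).2.
  by rewrite (metricC mr (st a m).2 (st a N).2); lra.
have h_near a n : r (st a n).2 (h a) <= c n.
  apply/ler_addgt0Pr => e e0; have [N NP] := hP a e e0.
  have := NP (maxn N n) (leq_maxl _ _); have := st_near a _ _ (leq_maxr N n).
  by have := metric_triangle mr (st a (maxn N n)).2 (st a n).2 (h a); lra.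
(* The slack [dl (n + k)] absorbs the next error, as [dl] at least halves at each level. *)
have st_conjg a n t k : t \in (st a n.+1).1 -> t \in (st a (n.+1 + k)%N).1 /\
    d (conjg (st a (n.+1 + k)%N).2 t) (conjg (st a n.+1).2 t) <=
      dl n - dl (n + k)%N.
  move=> tn; elim: k => [|k [tk IHk]];
    first by rewrite !addn0 metricxx // subrr.
  rewrite !addnS; have [_ /(_ t tk)[tk' dk]] := st_step a (n.+1 + k)%N;
    split=> //.
  move: dk; have := dlS (n + k)%N; have := dl0 (n + k).+1; move: IHk;
    rewrite addSn.
  have := metric_triangle md (conjg (st a (n + k).+1).2 t)
    (conjg (st a (n + k).+2).2 t) (conjg (st a n.+1).2 t).
  by move: (dl (n + k).+1) => x; lra.
have h_conjg a n t : t \in (st a n.+1).1 ->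
    d (conjg (h a) t) (conjg (st a n.+1).2 t) <= dl n.
  move=> tn; apply: dist_lsc => A B hA cB.
  have /(nbhs_dballP mr ir)[e e0 eA] := continuous_conjg hA.
  have [N NP] := hP a e e0.
  exists (conjg (st a (n.+1 + N)%N).2 t), (conjg (st a n.+1).2 t); split.
  - apply: eA; rewrite /dball /mkset (metricC mr).
    exact: (NP (n.+1 + N)%N (leq_addl _ _)).
  - exact: nbhs_singleton.
  - by have [_] := st_conjg a n t N tn; have := dl0 (n + N)%N; lra.
exists h; split.
  move=> a W /(nbhs_dballP mr ir)[e e0 eW].
  have [|N Ne] := @invS_lt (e / 2); first by rewrite divr_gt0.
  exists N => b ba; apply: eW; rewrite /dball /=.
  have := Ne N (leqnn N); rewrite -/(c N); have := h_near b N;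
  have := h_near a N.
  rewrite (stE b a N ba) (metricC mr _ (h a)).
  by have := metric_triangle mr (st a N).2 (h a) (h b); lra.
move=> a b n ab an bn.
have := FP (n, st a n); have := stP a n.
have := h_conjg a n; have := h_conjg b n;
  rewrite /= -(stE a b n ab) an bn /next.
case: (F _) => -[z w] f; case: (st a n) => l g /= hb ha gl /(_ gl).
move=> [[Pz Qw] _ _ [fw _]].
exists z, w; split=> //.
have := ha z (mem_head _ _); have := hb w (mem_head _ _).
move: fw; rewrite conjgM -(dist_conjg g).
have := metric_triangle md (conjg g z) (conjg (h a) z) (conjg (h b) w).
have := metric_triangle md (conjg g (conjg f w)) (conjg g z) (conjg (h b) w).
rewrite (metricC md (conjg g z) (conjg g _)).
rewrite (metricC md (conjg g (conjg f w)) (conjg (h b) w)).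
by have := dleps n; have := eps0 n; have := dl0 n; lra.
Qed.

(** * Non-meagre sets and the word set *)

Lemma nbhs_nonmeagre (O : set G) (x : G) : nbhs x O -> ~ meagre O.
Proof.
move=> /(nbhs_dballP mr ir)[e e0 eO] mO.
have cO : comeagre (~` O) by rewrite /comeagre setCK.
have [||y [/eO Oy]] := baire mr ir cr cO (O := dball r x e); last exact.
  by exists x; rewrite /dball /= metricxx.
exact: open_dball.
Qed.

(** With empty interior the closed set [ess_support D] would be nowhere dense, and [D] is covered by
    it and a meagre remainder. *)
Lemma nonmeagre_interior_ess_support (D : set G) : ~ meagre D ->
  interior (ess_support D) !=set0.
Proof.
move=> nD; apply: contrapT => D0; apply: nD.
have [B bB] := metric_countable_base mr ir sepG.
have : meagre ((D `\` ess_support D) `|` ess_support D).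
  apply: meagreU; first exact: meagre_setD_ess_support bB.
  apply: nowhere_dense_meagre; rewrite /nowhere_dense.
  rewrite -(proj1 (closure_id _) (@closed_ess_support _ D)) -subset0 => x Dx.
  by apply: D0; exists x.
by apply: sub_meagre => x Dx; have [?|?] := pselect (ess_support D x);
  [right|left].
Qed.

(** The six letters [y^-1 x p x^-1 y q^-1] are padded to ten, in the required pattern, by a factor
    [y^-1 y] on each side of [q^-1]. *)
Lemma word10_mem (A : set G) x y p q : A x -> A y -> A p^- -> A q^- ->
  word10 mul inv A (conjg (y^- ⋅ x) p ⋅ q^-).
Proof.
move=> Ax Ay Ap Aq; rewrite /word10.
have M B C b c : B b -> C c -> setmul mul B C (b ⋅ c).
  by move=> ? ?; exists b, c.
have I b : A b -> setinv inv A b^- by rewrite /setinv /= invK.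
have -> : conjg (y^- ⋅ x) p ⋅ q^- =
    y^- ⋅ x ⋅ p ⋅ x^- ⋅ y ⋅ y^- ⋅ y ⋅ q^- ⋅ y^- ⋅ y.
  by rewrite /conjg invM invK mulgK mulgKV !mulA.
by do 9!(apply: (M); last by [|exact: I]); exact: I.
Qed.

(* [g] avoids the neighbourhood of the word set, and a point of
   [conjg (y^-1 x) P] close to [Q = g A^-1] would put it there. The open set [U]
   on which [A^-1] is everywhere non-meagre meets [g U] because [g] is close to
   [1]; [P] is the part of [A^-1] in [U] and [g U]. *)
Lemma separated_pair (A : set G) (e : R) : ~ meagre A ->
  ~ interior (eps_nbhd d (word10 mul inv A) e) idG ->
  exists P Q : set G, [/\ ~ meagre P,
    forall (z : G) W, P z -> nbhs z W -> ~ meagre (Q `&` W) &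
    forall x y p q, A x -> A y -> P p -> Q q -> ~ d (conjg (y^- ⋅ x) p) q < e].
Proof.
move=> nA nW; pose D := inv @^-1` A.
have nD : ~ meagre D.
  move=> mD; apply: nA; rewrite (_ : A = inv @^-1` D).
    exact: (meagre_preimage continuous_inv continuous_inv invK invK).
  by apply/seteqP; split=> x; rewrite /D /= invK.
pose U := interior (ess_support D).
have oU : open U by exact: open_interior.
have [u Uu] := nonmeagre_interior_ess_support nD.
have [g Ug nWg] : exists2 g, U (g ⋅ u) & ~ eps_nbhd d (word10 mul inv A) e g.
  apply: contrapT => nWU; apply: nW.
  have : nbhs idG [set g | U (g ⋅ u)].
    by apply: continuous_mulr; rewrite mul1g; exact: open_nbhs_nbhs.
  by apply: filterS => g Ug; apply: contrapT => nWg; apply: nWU; exists g.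
exists (D `&` (U `&` (mul g^- @^-1` U))), (mul g^- @^-1` D); split.
- apply: (interior_subset Ug); apply: filterI; first exact: open_nbhs_nbhs.
  by apply: continuous_mull; rewrite mulKg; exact: open_nbhs_nbhs.
- move=> z W [_ [_ /interior_subset zD]] zW mQW.
  apply: (zD (mul g @^-1` W)); first by apply: continuous_mull; rewrite mulKVg.
  have := meagre_preimage (@continuous_mull g) (@continuous_mull g^-)
    (mulKg g) (mulKVg g) mQW.
  by apply: sub_meagre => x [Dx Wx]; split=> //=; rewrite mulKg.
- move=> x y p q Ax Ay [Dp _] Dq dpq; apply: nWg.
  (* The word equals [conjg (y^-1 x) p q^-1 g], while [g = q q^-1 g]; right invariance reduces their
     distance to that of [conjg (y^-1 x) p] and [q]. *)
  exists (conjg (y^- ⋅ x) p ⋅ (g^- ⋅ q)^-); first exact: word10_mem.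
  rewrite invM invK mulA -{1}(mul1g g) -(mulgV q) !dist_mulr.
  by rewrite (metricC md).
Qed.

Lemma meagre_ltrans k (A : set G) : meagre A -> meagre (ltrans mul k A).
Proof.
move=> mA; have -> : ltrans mul k A = mul k^- @^-1` A.
  apply/seteqP; split=> [_ [x Ax <-]|x Ax] /=; first by rewrite mulKg.
  by exists (k^- ⋅ x) => //; rewrite mulKVg.
exact: (meagre_preimage (@continuous_mull k^-) (@continuous_mull k)
  (mulKVg k) (mulKg k) mA).
Qed.

Lemma word10_nbhs_of_cover (k : nat -> G) (A : nat -> set G) :
  comeagre (\bigcup_n ltrans mul (k n) (A n)) ->
  exists n, forall e, 0 < e ->
    interior (eps_nbhd d (word10 mul inv (A n)) e) idG.
Proof.
move=> Hcov; apply: contrapT => /forallNP nW.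
have /choice[e eP] : forall n, exists e : R, 0 < e /\
    ~ interior (eps_nbhd d (word10 mul inv (A n)) e) idG.
  move=> n; have /existsNP[e /not_implyP[e0 ne]] := nW n; by exists e.
(* [A' n] is [A n] or empty; the translates thus dropped form a meagre set. *)
pose A' n := [set x | A n x /\ ~ meagre (A n)].
have cA' : comeagre (\bigcup_n ltrans mul (k n) (A' n)).
  have : comeagre (~` \bigcup_n
      (ltrans mul (k n) [set x | A n x /\ meagre (A n)])).
    rewrite /comeagre setCK; apply: meagre_bigcup => n; apply: meagre_ltrans.
    have [mA|nA] := pselect (meagre (A n));
      first by apply: sub_meagre mA => x [].
    by apply: sub_meagre meagre0 => x [].
  move=> /(comeagreI Hcov); apply: sub_comeagre => _ [[n _ [x Ax <-]] nm].
  exists n => //; exists x => //; split=> // mA; apply: nm.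
  by exists n => //; exists x.
have /choice[PQ PQP] : forall n, exists PQ : set G * set G, [/\ ~ meagre PQ.1,
    forall (z : G) W, PQ.1 z -> nbhs z W -> ~ meagre (PQ.2 `&` W) &
    forall x y p q, A' n x -> A' n y -> PQ.1 p -> PQ.2 q ->
      ~ d (conjg (y^- ⋅ x) p) q < e n].
  move=> n; have [mA|nA] := pselect (meagre (A n)).
    (* Here [A' n] is empty, so the separation condition is vacuous. *)
    exists (setT, setT); split=> /=; last by move=> x y p q [].
      by apply: (@nbhs_nonmeagre _ idG); exact: filterT.
    by move=> z W _ zW; rewrite setTI; exact: nbhs_nonmeagre zW.
  have [P [Q [nP nQ PQe]]] := separated_pair nA (eP n).2.
  by exists (P, Q); split=> // x y p q [Ax _] [Ay _]; exact: PQe.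
pose phi n := logn 2 n.
have [|||h [h_cont h_split]] := @cantor_scheme (fun n => (PQ (phi n)).1)
    (fun n => (PQ (phi n)).2) (fun n => e (phi n)).
- by move=> n; have [] := eP (phi n).
- by move=> n; have [] := PQP (phi n).
- by move=> n; have [] := PQP (phi n).
have [U oU UA'] := (comeagreP _).1 cA'.
(* The eventually false paths are countably many and dense in [2^N]. One translate [g] brings the
   values of [h] at all of them into every [U i]; by continuity of [h], the condition of lying in
   [U i] then holds on a dense open set of paths. *)
have [g Ug] : exists g, forall i s, U i (g ⋅ h (nth false s)).
  have : comeagre [set g | forall p : nat * seq bool,
    U p.1 (g ⋅ h (nth false p.2))].
    apply: comeagre_forall => -[i s] /=; have [oUi dUi] := oU i.
    apply: (comeagre_preimage (f := mul^~ (h (nth false s)))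
      (g := mul^~ (h (nth false s))^-)).
    - exact: continuous_mulr.
    - exact: continuous_mulr.
    - by move=> g; rewrite mulgK.
    - by move=> g; rewrite mulgKV.
    - exact: open_dense_comeagre.
  move=> /(baire mr ir cr)/(_ [set: G])[||g [_ Ug]].
  - by exists idG.
  - exact: openT.
  - by exists g => i s; exact: (Ug (i, s)).
(* A path with all these properties is contradictory: [g ⋅ h a] lies in the cover by the first kind
   and in no piece by the second. *)
have [|a aD] := @cantor_baire _ (fun im : nat + nat => match im with
  | inl i => [set a | U i (g ⋅ h a)]
  | inr m => [set a | ~ ltrans mul (k m) (A' m) (g ⋅ h a)] end).
- case=> [i|m] a n.
    have aU := Ug i (mkseq a n).
    have [|N hN] := h_cont (nth false (mkseq a n)) (mul g @^-1` U i).
      by apply: continuous_mull; apply: open_nbhs_nbhs; split=> //;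
        have [] := oU i.
    exists (nth false (mkseq a n)), N; split=> [j jn|c cb];
      first by rewrite nth_mkseq.
    exact: hN.
  have [n' nn' phin'] := logn2_surj m n.
  (* A prefix of [a], then zeros, then the bit [b] at a level [n'] devoted to [m]. If no smaller
     cylinder avoids piece [m], both values of [b] give paths into that piece, and these split at
     [n']. *)
  pose a0 b j := if (j < n)%N then a j else (j == n') && b.
  apply: contrapT => noD.
  have hit b : exists c, (forall j, (j < n'.+1)%N -> c j = a0 b j) /\
      ltrans mul (k m) (A' m) (g ⋅ h c).
    apply: contrapT => noc; apply: noD; exists (a0 b), n'.+1; split.
      by move=> j jn; rewrite /a0 jn.
    by move=> c ca cA; apply: noc; exists c.
  have [c0 [c0a [x Ax xc]]] := hit false; have [c1 [c1a [y Ay yc]]] := hit true.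
  have a0n' b : a0 b n' = b by rewrite /a0 ltnNge nn' eqxx.
  have [|||p [q [Pp Qq dpq]]] := h_split c0 c1 n'.
  + move=> i ni; have niS : (i < n'.+1)%N by exact: ltnW.
    by rewrite c0a // c1a // /a0 ltn_eqF.
  + by rewrite c0a.
  + by rewrite c1a.
  have [_ _ sep] := PQP m; rewrite /phi phin' in Pp Qq dpq.
  (* Both [g] and [k m] cancel in the quotient. *)
  have hc : (h c1)^- ⋅ h c0 = y^- ⋅ x.
    have /(congr1 inv) : h c1 = g^- ⋅ (k m ⋅ y) by rewrite yc mulKg.
    rewrite !invM invK => ->.
    have -> : h c0 = g^- ⋅ (k m ⋅ x) by rewrite xc mulKg.
    by rewrite -!mulA mulKVg mulKg.
  apply: (sep _ _ _ _ Ax Ay Pp Qq).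
  by rewrite -hc -(dist_conjg (h c1)) -conjgM mulKVg.
have [m _ Am] : (\bigcup_n ltrans mul (k n) (A' n)) (g ⋅ h a).
  by apply: UA' => i _; exact: (aD (inl i)).
exact: (aD (inr m)).
Qed.

End topometric.

Theorem theorem4p6 (G : topologicalType) (mul : G -> G -> G) (inv : G -> G)
  (idG : G) (d : G -> G -> Rdefinitions.R)
  (HG : polish_topometric_group mul inv idG d)
  (Hamp : ample_generics mul inv d)
  (k : nat -> G) (A : nat -> set G)
  (Hcov : comeagre (\bigcup_n ltrans mul (k n) (A n))) :
  exists n : nat, forall eps : Rdefinitions.R, 0 < eps ->
    interior (eps_nbhd d (word10 mul inv (A n)) eps) idG.
Proof.
have [[_ _ _ [sepG [r [mr ir cr]]]] _ _ _ _] := HG.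
exact: (word10_nbhs_of_cover HG mr ir cr sepG Hamp Hcov).
Qed.
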